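(* Let $\{\Phi_u\}_{u\in U}$, $\{\Phi_v\}_{v\in V}$ and $\{\Phi_{u,v}\}_{(u,v)\in U\times V}$ be parameterised families of iterated function systems on $\mathbb{R}^d$ as defined in the context, with associated sets $H_1(n), H_1^*(n)\subseteq U$, $H_2(n),H_2^*(n)\subseteq V$ and $H_3(n)\subseteq U\times V$. Suppose that the following properties are satisfied: 1. $\bigcup_{n=1}^{\infty}H_{1}(n)\neq \emptyset$ and $\bigcup_{n=1}^{\infty}H_{2}(n)\neq \emptyset$. 2. For any $n_0,m_0\in\mathbb{N}$, any $u\in H_{1}(n_0)$, any $v\in H_{2}(m_0)$, and any $\epsilon>0$, there exists $u_1\in \bigcup_{n=\max\{n_0,m_0\}+1}^{\infty}H_{1}^*(n)$ such that both of the following hold: (a) $\|u-u_1\|_{\infty}<\epsilon$; (b) for any $\epsilon'>0$ there exists $v_1\in \bigcup_{n=\max\{n_0,m_0\}+1}^{\infty}H_{2}^*(n)$ such that $\|v-v_1\|_{\infty}<\epsilon'$ and $(u_1,v_1)\notin H_{3}(\max\{n_0,m_0\})$. Then for any sequence $(\omega_n)_{n=1}^{\infty}$ of strictly positive real numbers, there exists $(u^*,v^* )\in U\times V$ such that $\Delta_n(\Phi_{u^*,v^*})\leq \omega_n$ for all $n$ sufficiently large and $\Phi_{u^*,v^*}$ contains no exact overlaps.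
   Context: Throughout, $\mathbb{N}=\{1,2,3,\dots\}$, $\|\cdot\|_\infty$ is the supremum norm on a Euclidean space, and $\mathcal{O}(d)$ is the group of $d\times d$ real orthogonal matrices with the topology inherited from $\mathbb{R}^{d\times d}$. Iterated function systems. An iterated function system (IFS) on $\mathbb{R}^d$ is a finite set $\Phi=\{\phi_i\}_{i\in\mathcal{I}}$ of contracting similarities of $\mathbb{R}^d$. Each contracting similarity is written uniquely as $\phi(x)=r\,Ox+t$ with $r\in(0,1)$, $O\in\mathcal{O}(d)$, $t\in\mathbb{R}^d$. For a word $\mathbf{a}=(a_1,\dots,a_n)\in\mathcal{I}^n$ put $\phi_{\mathbf{a}}:=\phi_{a_1}\circ\cdots\circ\phi_{a_n}$. The IFS $\Phi$ contains an exact overlap if there are distinct words $\mathbf{a},\mathbf{b}\in\bigcup_{n=1}^\infty\mathcal{I}^n$ with $\phi_{\mathbf{a}}=\phi_{\mathbf{b}}$; otherwise it contains no exact overlaps. Distance. For contracting similarities $\phi(x)=r\,Ox+t$ and $\phi'(x)=r'O'x+t'$ define $$d(\phi,\phi')=|t-t'|+|\log r-\log r'|+\|O-O'\|,$$ where $|t-t'|$ is the Euclidean norm and $\|\cdot\|$ is the operator norm. For an IFS $\Phi=\{\phi_i\}_{i\in\mathcal{I}}$ and $n\in\mathbb{N}$ define $$\Delta_n(\Phi):=\min\{d(\phi_{\mathbf{a}},\phi_{\mathbf{b}}):\mathbf{a},\mathbf{b}\in\mathcal{I}^n,\ \mathbf{a}\neq\mathbf{b}\}.$$ Parameterised families. Let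 $U\subset\mathbb{R}^{k_1}$ and $V\subset\mathbb{R}^{k_2}$ be open, and let $\mathcal{I}_1,\mathcal{I}_2,\mathcal{I}_3$ be finite sets ($\mathcal{I}_3=\emptyset$ is allowed). For each $i\in\mathcal{I}_1$ let $O_{i,1}:U\to\mathcal{O}(d)$, $r_{i,1}:U\to(0,1)$, $t_{i,1}:U\to\mathbb{R}^d$ be continuous; for each $i\in\mathcal{I}_2$ let $O_{i,2}:V\to\mathcal{O}(d)$, $r_{i,2}:V\to(0,1)$, $t_{i,2}:V\to\mathbb{R}^d$ be continuous; for each $i\in\mathcal{I}_3$ let $O_{i,3}:U\times V\to\mathcal{O}(d)$, $r_{i,3}:U\times V\to(0,1)$, $t_{i,3}:U\times V\to\mathbb{R}^d$ be continuous. For $u\in U$, $v\in V$ define the IFSs $$\Phi_u:=\{\phi_{i,u}(x)=r_{i,1}(u)\,O_{i,1}(u)x+t_{i,1}(u)\}_{i\in\mathcal{I}_1},\qquad \Phi_v:=\{\phi_{i,v}(x)=r_{i,2}(v)\,O_{i,2}(v)x+t_{i,2}(v)\}_{i\in\mathcal{I}_2},$$ $$\Phi_{u,v}:=\Phi_u\cup\Phi_v\cup\{\phi_{i,u,v}(x)=r_{i,3}(u,v)\,O_{i,3}(u,v)x+t_{i,3}(u,v)\}_{i\in\mathcal{I}_3}.$$ For a word $\mathbf{a}$ over the index set of $\Phi_u$, $\Phi_v$ or $\Phi_{u,v}$, the maps $\phi_{\mathbf{a},u}$, $\phi_{\mathbf{a},v}$, $\phi_{\mathbf{a},u,v}$ denote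 the corresponding compositions of maps from $\Phi_u$, $\Phi_v$, $\Phi_{u,v}$ respectively. Overlap sets. For $n\in\mathbb{N}$, $$H_1(n):=\{u\in U:\phi_{\mathbf{a},u}=\phi_{\mathbf{b},u}\text{ for some }\mathbf{a},\mathbf{b}\in\mathcal{I}_1^n,\ \mathbf{a}\neq\mathbf{b}\},\qquad H_1^*(n):=H_1(n)\setminus\bigcup_{j=1}^{n-1}H_1(j).$$ The sets $H_2(n)$ and $H_2^*(n)$ are the corresponding subsets of $V$ for the family $\{\Phi_v\}_{v\in V}$: $$H_2(n):=\{v\in V:\phi_{\mathbf{a},v}=\phi_{\mathbf{b},v}\text{ for some }\mathbf{a},\mathbf{b}\in\mathcal{I}_2^n,\ \mathbf{a}\neq\mathbf{b}\},\qquad H_2^*(n):=H_2(n)\setminus\bigcup_{j=1}^{n-1}H_2(j).$$ The set $H_3(n)$ is the corresponding subset of $U\times V$ for the family $\{\Phi_{u,v}\}_{(u,v)\in U\times V}$, i.e. the set of $(u,v)\in U\times V$ such that $\phi_{\mathbf{a},u,v}=\phi_{\mathbf{b},u,v}$ for some two distinct words $\mathbf{a}\neq\mathbf{b}$ of length $n$ over the index set of the IFS $\Phi_{u,v}$. *)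

(* Defs.v *)
From HB Require Import structures.
From mathcomp Require Import all_boot all_order all_algebra.
From mathcomp Require Import all_classical all_reals all_analysis.

Set Implicit Arguments.
Unset Strict Implicit.
Unset Printing Implicit Defensive.

Import Order.TTheory GRing.Theory Num.Theory.
Import numFieldNormedType.Exports.

Local Open Scope classical_set_scope.
Local Open Scope ring_scope.

(* The norm `|x| that the library puts on matrices and vectors is the
   supremum norm, so the Euclidean norm and the operator norm it induces are
   defined here. *)
Definition l2norm (R : realType) (d : nat) (x : 'cV[R]_d) : R :=
  Num.sqrt (\sum_i x i 0 ^+ 2).

Definition opnorm (R : realType) (d : nat) (A : 'M[R]_d) : R :=
  sup [set l2norm (A *m x) | x in [set x | l2norm x <= 1]].

(* The map x |-> r O x + t is carried by its data (r, O, t); that r lies in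
   (0, 1) and that O is orthogonal are imposed by [contracting_similarity].
   By [similarity_inj] these data are determined by the map. *)
Record similarity (R : realType) (d : nat) := Similarity {
  sim_r : R;
  sim_O : 'M[R]_d;
  sim_t : 'cV[R]_d
}.

Definition sim_fun (R : realType) (d : nat) (f : similarity R d)
    (x : 'cV[R]_d) : 'cV[R]_d :=
  sim_r f *: (sim_O f *m x) + sim_t f.

Coercion sim_fun : similarity >-> Funclass.

Definition orthogonal_mx (R : realType) (d : nat) (A : 'M[R]_d) : Prop :=
  A *m A^T = 1%:M.

Definition contracting_similarity (R : realType) (d : nat)
    (f : similarity R d) : Prop :=
  0 < sim_r f < 1 /\ orthogonal_mx (sim_O f).

Definition sim_id (R : realType) (d : nat) : similarity R d :=
  Similarity 1 1%:M 0.

Definition sim_comp (R : realType) (d : nat) (f g : similarity R d) :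
    similarity R d :=
  Similarity (sim_r f * sim_r g) (sim_O f *m sim_O g) (f (sim_t g)).

Lemma sim_idE (R : realType) (d : nat) : sim_id R d =1 id.
Proof. by move=> x; rewrite /sim_fun /= scale1r mul1mx addr0. Qed.

Lemma sim_compE (R : realType) (d : nat) (f g : similarity R d) :
  sim_comp f g =1 f \o g.
Proof.
move=> x; rewrite /= /sim_fun /= mulmxDr -scalemxAr scalerDr scalerA mulmxA.
by rewrite addrA.
Qed.

Lemma similarity_inj (R : realType) (d : nat) (f g : similarity R d) :
  (0 < d)%N -> contracting_similarity f -> contracting_similarity g ->
  f =1 g -> f = g.
Proof.
case: f => r O t; case: g => r' O' t' d0 [/= /andP[r0 _] OO] [/= /andP[r'0 _] OO'].
move=> fg.
have tt : t = t' by move: (fg 0); rewrite /sim_fun /= !mulmx0 !scaler0 !add0r.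
have rO : r *: O = r' *: O'.
  apply/matrixP => i j; move: (fg (delta_mx j 0)).
  rewrite /sim_fun /= tt => /addIr.
  rewrite !scalemxAl -!colE => /matrixP/(_ i 0).
  by rewrite !mxE.
have rr : r = r'.
  have : (r *: O) *m (r *: O)^T = (r' *: O') *m (r' *: O')^T by rewrite rO.
  rewrite !linearZ /= -!scalemxAl OO OO' !scalerA.
  move=> /matrixP/(_ (Ordinal d0) (Ordinal d0)); rewrite !mxE eqxx !mulr1.
  by rewrite -!expr2 => /eqP; rewrite eqrXn2 ?ltW// => /eqP.
by rewrite tt rr in rO *; congr Similarity; apply: (scalerI (lt0r_neq0 r'0)).
Qed.

Definition word_map (R : realType) (d : nat) (I : Type)
    (phi : I -> similarity R d) (a : seq I) : similarity R d :=
  foldr (fun i f => sim_comp (phi i) f) (sim_id R d) a.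

Definition sim_dist (R : realType) (d : nat) (f g : similarity R d) : R :=
  l2norm (sim_t f - sim_t g) + `|ln (sim_r f) - ln (sim_r g)|
  + opnorm (sim_O f - sim_O g).

(* Extended-real valued so that the minimum over the empty set, which occurs
   when there are no two distinct words of length n, is +oo. *)
Definition Delta (R : realType) (d : nat) (I : finType)
    (phi : I -> similarity R d) (n : nat) : \bar R :=
  \big[mine/+oo%E]_(ab : n.-tuple I * n.-tuple I | ab.1 != ab.2)
    (sim_dist (word_map phi ab.1) (word_map phi ab.2))%:E.

(* The two words need not have the same length. *)
Definition exact_overlap (R : realType) (d : nat) (I : finType)
    (phi : I -> similarity R d) : Prop :=
  exists a b : seq I,
    [/\ a != [::], b != [::], a != b & word_map phi a =1 word_map phi b].

(* The maps are total on the ambient space T; only their values on the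
   parameter set D are constrained or used. *)
Record parameterised_ifs (R : realType) (d : nat) (T : topologicalType)
    (D : set T) (I : finType) (Phi : T -> I -> similarity R d) : Prop := {
  pifs_contracting : forall i x, D x -> contracting_similarity (Phi x i);
  pifs_cont_r : forall i, {within D, continuous (fun x => sim_r (Phi x i))};
  pifs_cont_O : forall i, {within D, continuous (fun x => sim_O (Phi x i))};
  pifs_cont_t : forall i, {within D, continuous (fun x => sim_t (Phi x i))}
}.

Definition joint_ifs (R : realType) (d : nat) (S T : Type)
    (I1 I2 I3 : finType)
    (Phi1 : S -> I1 -> similarity R d) (Phi2 : T -> I2 -> similarity R d)
    (Phi3 : S * T -> I3 -> similarity R d)
    (uv : S * T) (i : I1 + I2 + I3) : similarity R d :=
  match i with
  | inl (inl i1) => Phi1 uv.1 i1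
  | inl (inr i2) => Phi2 uv.2 i2
  | inr i3 => Phi3 uv i3
  end.

Definition overlap_set (R : realType) (d : nat) (T : Type) (D : set T)
    (I : finType) (Phi : T -> I -> similarity R d) (n : nat) : set T :=
  [set x | D x /\ exists a b : n.-tuple I,
    a != b /\ word_map (Phi x) a =1 word_map (Phi x) b].

Definition new_overlap_set (R : realType) (d : nat) (T : Type) (D : set T)
    (I : finType) (Phi : T -> I -> similarity R d) (n : nat) : set T :=
  overlap_set D Phi n `\`
    \bigcup_(j in [set j | (1 <= j < n)%N]) overlap_set D Phi j.

(* Main.v *)
(* Alternate between the two families. An overlap of Phi_v at level m makes
   Delta_n vanish for all n >= m and every Phi_(u, v), so Delta_n <= omega_n
   persists near v for any finite range of n >= m, and similarly for u. Given
   overlapping parameters u at level n and v at level m, first move u to u1,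
   overlapping at a level n1; then move v to v1, overlapping at a level m1, so
   little that v still controls the levels from m to n1. Controlling the levels
   from n1 to m1 is left to a neighbourhood of u1, chosen once m1 is known. The
   condition (u1, v1) \notin H3 (maxn n m) is open and can be kept in the limit,
   and the levels tend to infinity, so the limit point lies in no H3 n, which
   excludes exact overlaps. *)
Require Import Defs.
From HB Require Import structures.
From mathcomp Require Import all_boot all_order all_algebra.
From mathcomp Require Import all_classical all_reals all_analysis.
Import Order.TTheory GRing.Theory Num.Theory.
Import numFieldNormedType.Exports.
Local Open Scope classical_set_scope.
Local Open Scope ring_scope.

Set Implicit Arguments.
Unset Strict Implicit.

(** * Words, overlap sets and exact overlaps *)

Lemma word_map_cat (R : realType) (d : nat) (I : Type)
    (phi : I -> similarity R d) (a b : seq I) :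
  word_map phi (a ++ b) =1 word_map phi a \o word_map phi b.
Proof.
elim: a => [|i a IHa] x /=; first by rewrite sim_idE.
by rewrite !sim_compE /= IHa.
Qed.

Lemma sim_r_word_map_cat (R : realType) (d : nat) (I : Type)
    (phi : I -> similarity R d) (a b : seq I) :
  sim_r (word_map phi (a ++ b)) =
  sim_r (word_map phi a) * sim_r (word_map phi b).
Proof. by elim: a => [|i a IHa] /=; rewrite ?mul1r // IHa mulrA. Qed.

Lemma word_map_map (R : realType) (d : nat) (I J : Type) (h : J -> I)
    (phi : I -> similarity R d) (psi : J -> similarity R d) (a : seq J) :
  (forall j, phi (h j) = psi j) -> word_map phi (map h a) = word_map psi a.
Proof. by move=> phih; elim: a => //= j a ->; rewrite phih. Qed.

Lemma contracting_word_map (R : realType) (d : nat) (I : Type)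
    (phi : I -> similarity R d) (a : seq I) :
  (forall i, contracting_similarity (phi i)) -> (0 < size a)%N ->
  contracting_similarity (word_map phi a).
Proof.
move=> phiC; case: a => [//|i a] _; elim: a i => [|j a IHa] i.
  have [/= ri Oi] := phiC i; split=> /=; first by rewrite mulr1.
  by rewrite mulmx1.
have [/andP[ri0 ri1] Oi] := phiC i.
have [/andP[ra0 ra1] Oa] := IHa j.
split; rewrite [word_map _ _]/=; first by rewrite mulr_gt0 //= mulr_ilt1 // ltW.
by rewrite /orthogonal_mx trmx_mul mulmxA -(mulmxA (sim_O (phi i))) Oa mulmx1.
Qed.

(** Overlaps are equalities of functions, while [sim_dist] and the ratios depend on the data (r, O,
    t). Nonempty words are contracting, whereas [sim_id] has ratio 1. *)
Lemma word_map_inj (R : realType) (d : nat) (I : Type)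
    (phi : I -> similarity R d) (a b : seq I) :
  (0 < d)%N -> (forall i, contracting_similarity (phi i)) ->
  (0 < size a)%N -> (0 < size b)%N -> word_map phi a =1 word_map phi b ->
  word_map phi a = word_map phi b.
Proof.
by move=> d0 phiC a0 b0; apply: similarity_inj => //; exact: contracting_word_map.
Qed.

(** Prepending a common letter to two words keeps them distinct and their maps equal. The head of
    [a] supplies the letter; at length 0 there is only one word. *)
Lemma overlap_set_le (R : realType) (d : nat) (T : Type) (D : set T)
    (I : finType) (Phi : T -> I -> similarity R d) (m n : nat) :
  (m <= n)%N -> overlap_set D Phi m `<=` overlap_set D Phi n.
Proof.
move=> /subnK <-; elim: (n - m)%N => [//|k IHk] x /IHk {IHk}.
rewrite addSn; case: (k + m)%N => [|p] [Dx [a [b [ab eab]]]]; split=> //.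
  by rewrite (tuple0 a) (tuple0 b) eqxx in ab.
exists [tuple of thead a :: a], [tuple of thead a :: b]; split.
  by apply: contra ab => /eqP/(congr1 val)[ab]; apply/eqP/val_inj.
by move=> y /=; rewrite !sim_compE /= eab.
Qed.

(* If ab = ba then one of a, b is a prefix of the other, so that the two maps
   have distinct contraction ratios; hence ab and ba are distinct words of the
   same length. *)
Lemma exact_overlap_overlap_set (R : realType) (d : nat) (T : Type) (D : set T)
    (I : finType) (Phi : T -> I -> similarity R d) (x : T) :
  (0 < d)%N -> D x -> (forall i, contracting_similarity (Phi x i)) ->
  exact_overlap (Phi x) -> exists n, overlap_set D Phi n x.
Proof.
move=> d0 Dx PhiC [a [b [a0 b0 ab eab]]]; exists (size a + size b)%N.
split=> //.
have sab : size (a ++ b) == (size a + size b)%N by rewrite size_cat.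
have sba : size (b ++ a) == (size a + size b)%N by rewrite size_cat addnC.
exists (Tuple sab), (Tuple sba); split; last first.
  by move=> y /=; rewrite !word_map_cat /= !eab.
apply/eqP => /(congr1 val) /= abba.
wlog leab : a b a0 b0 ab eab abba {sab sba} / (size a <= size b)%N.
  move=> W; have [|/ltnW] := leqP (size a) (size b); first exact: W abba.
  by apply: W (esym abba) => //; rewrite eq_sym.
have eb : b = a ++ drop (size a) b.
  rewrite -{1}(cat_take_drop (size a) b); congr (_ ++ _).
  by have := congr1 (take (size a)) abba; rewrite take_size_cat // takel_cat.
have c0 : (0 < size (drop (size a) b))%N.
  rewrite lt0n size_eq0; apply: contra ab => /eqP c0.
  by rewrite eb c0 cats0 eqxx.
have [a0' b0'] : (0 < size a)%N /\ (0 < size b)%N by rewrite !lt0n !size_eq0.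
have /andP[ra _] := (contracting_word_map PhiC a0').1.
have /andP[_ rc] := (contracting_word_map PhiC c0).1.
have := congr1 (@sim_r _ _) (word_map_inj d0 PhiC a0' b0' eab).
rewrite eb sim_r_word_map_cat => /eqP.
rewrite -{1}[sim_r _]mulr1 (inj_eq (mulfI (lt0r_neq0 ra))) => /eqP rc1.
by rewrite -rc1 ltxx in rc.
Qed.

(** * Entrywise upper bounds for the distance *)

Lemma l2norm_le_sum (R : realType) (d : nat) (x : 'cV[R]_d) :
  l2norm x <= \sum_i `|x i 0|.
Proof.
have s0 : 0 <= \sum_i `|x i 0| by apply: sumr_ge0.
rewrite /l2norm -[leRHS]ger0_norm // -sqrtr_sqr ler_wsqrtr //.
suff [] : \sum_i x i 0 ^+ 2 <= (\sum_i `|x i 0|) ^+ 2 /\ 0 <= \sum_i `|x i 0| by [].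
apply: (big_ind2 (fun s t : R => s <= t ^+ 2 /\ 0 <= t))
  => [|s t s' t' [st t0] [st' t'0]|i _].
- by rewrite expr0n.
- split; last exact: addr_ge0.
  rewrite (le_trans (lerD st st')) // sqrrD lerD2r lerDl.
  by rewrite mulrn_wge0 // mulr_ge0.
- by rewrite real_normK ?num_real.
Qed.

(** On the Euclidean unit ball every coordinate is at most 1 in absolute value. *)
Lemma opnorm_le_sum (R : realType) (d : nat) (A : 'M[R]_d) :
  opnorm A <= \sum_i \sum_j `|A i j|.
Proof.
have l2norm_ge i (x : 'cV[R]_d) : `|x i 0| <= l2norm x.
  rewrite -sqrtr_sqr ler_wsqrtr // (bigD1 i) //= lerDl.
  by apply: sumr_ge0 => j _; exact: sqr_ge0.
apply: ge_sup.
  exists (l2norm (A *m 0)), 0 => //=.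
  by rewrite (le_trans (l2norm_le_sum _)) // big1 // => i _; rewrite mxE normr0.
move=> _ [x /= x1 <-]; rewrite (le_trans (l2norm_le_sum _)) //.
apply: ler_sum => i _; rewrite mxE (le_trans (ler_norm_sum _ _ _)) //.
apply: ler_sum => j _; rewrite normrM ler_piMr //.
exact: le_trans (l2norm_ge _ _) x1.
Qed.

(** Smallness of [sim_dist] will follow from this bound, whose continuity is checked entry by entry,
    without treating the supremum in [opnorm]. *)
Lemma sim_dist_le_sum (R : realType) (d : nat) (f g : similarity R d) :
  sim_dist f g <= \sum_i `|sim_t f i 0 - sim_t g i 0|
    + `|ln (sim_r f) - ln (sim_r g)|
    + \sum_i \sum_j `|sim_O f i j - sim_O g i j|.
Proof.
rewrite /sim_dist lerD //.
  rewrite lerD2r (le_trans (l2norm_le_sum _)) //.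
  by apply: ler_sum => i _; rewrite !mxE.
rewrite (le_trans (opnorm_le_sum _)) //.
by apply: ler_sum => i _; apply: ler_sum => j _; rewrite !mxE.
Qed.

(** * Continuous dependence of the maps on the parameter *)

(** Stated entrywise, so that compositions reduce to sums and products of real functions. *)
Definition sim_continuous_at (R : realType) (d : nat) (X : topologicalType)
    (x0 : X) (f : X -> similarity R d) : Prop :=
  [/\ {for x0, continuous (fun x => sim_r (f x))},
      forall i j, {for x0, continuous (fun x => sim_O (f x) i j)}
    & forall i, {for x0, continuous (fun x => sim_t (f x) i 0)}].

Lemma continuous_at_sum (R : realType) (X : topologicalType) (x0 : X)
    (I : finType) (F : I -> X -> R) :
  (forall i, {for x0, continuous (F i)}) ->
  {for x0, continuous (fun x => \sum_i F i x)}.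
Proof.
move=> cF; apply: cvg_big => [|i _]; first exact: add_continuous.
exact: cF.
Qed.

Lemma sim_continuous_at_comp (R : realType) (d : nat) (X : topologicalType)
    (x0 : X) (f g : X -> similarity R d) :
  sim_continuous_at x0 f -> sim_continuous_at x0 g ->
  sim_continuous_at x0 (fun x => sim_comp (f x) (g x)).
Proof.
move=> [rf Of tf] [rg Og tg]; split=> [|i j|i].
- exact: continuousM rf rg.
- under [X in {for _, continuous X}]funext do rewrite mxE.
  apply: continuous_at_sum => k; exact: continuousM (Of _ _) (Og _ _).
- under [X in {for _, continuous X}]funext do rewrite /= /sim_fun 2!mxE mxE.
  apply: continuousD (tf _); apply: continuousM => //.
  apply: continuous_at_sum => k; exact: continuousM (Of _ _) (tg _).
Qed.

Lemma sim_continuous_at_word_map (R : realType) (d : nat) (X : topologicalType)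
    (x0 : X) (I : Type) (Phi : X -> I -> similarity R d) (a : seq I) :
  (forall i, sim_continuous_at x0 (Phi^~ i)) ->
  sim_continuous_at x0 (fun x => word_map (Phi x) a).
Proof.
move=> cPhi; elim: a => [|i a IHa] /=; last exact: sim_continuous_at_comp.
by split=> *; exact: cst_continuous.
Qed.

Lemma near_sim_fun_neq (R : realType) (d : nat) (X : topologicalType) (x0 : X)
    (f g : X -> similarity R d) :
  sim_continuous_at x0 f -> sim_continuous_at x0 g -> ~ (f x0 =1 g x0) ->
  \forall x \near x0, ~ (f x =1 g x).
Proof.
move=> cf cg /existsNP[y /eqP fgy].
(* Composing with the constant translation by [y] turns the value at [y] into a translation part,
   whose continuity is already known. *)
have cy : sim_continuous_at x0 (fun _ => Similarity 1 1%:M y).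
  by split=> *; exact: cst_continuous.
have [i fgi] : exists i, f x0 y i 0 != g x0 y i 0.
  apply/existsP; apply: contraR fgy => /existsPn fgy.
  by apply/eqP/matrixP => i j; rewrite ord1; exact/eqP/negPn/fgy.
have [_ _ /(_ i) cfy] := sim_continuous_at_comp cf cy.
have [_ _ /(_ i) cgy] := sim_continuous_at_comp cg cy.
rewrite -subr_eq0 in fgi.
have /(_ (nbhs_filter x0)) := cvgr_neq0 _ (continuousB cfy cgy) fgi.
apply: filterS => x + fg; rewrite -[X in X != 0]/(f x y i 0 - g x y i 0).
by rewrite fg subrr eqxx.
Qed.

(** The entrywise majorant [B] vanishes at [x0] and is continuous there, the positive ratio giving
    continuity of the logarithm. *)
Lemma near_sim_dist_le (R : realType) (d : nat) (X : topologicalType) (x0 : X)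
    (f g : X -> similarity R d) (e : R) :
  sim_continuous_at x0 f -> sim_continuous_at x0 g ->
  f x0 = g x0 -> 0 < sim_r (f x0) -> 0 < e ->
  \forall x \near x0, sim_dist (f x) (g x) <= e.
Proof.
move=> [rf Of tf] [rg Og tg] fg r0 e0.
have cdist (F G : X -> R) : {for x0, continuous F} -> {for x0, continuous G} ->
    {for x0, continuous (fun x => `|F x - G x|)}.
  by move=> cF cG; apply: cvg_norm; exact: cvgB cF cG.
have cln (h : X -> similarity R d) : {for x0, continuous (fun x => sim_r (h x))} ->
    0 < sim_r (h x0) -> {for x0, continuous (fun x => ln (sim_r (h x)))}.
  by move=> ch h0; apply: continuous_comp ch _; exact: continuous_ln.
pose B x : R := \sum_i `|sim_t (f x) i 0 - sim_t (g x) i 0|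
  + `|ln (sim_r (f x)) - ln (sim_r (g x))|
  + \sum_i \sum_j `|sim_O (f x) i j - sim_O (g x) i j|.
have cB : {for x0, continuous B}.
  apply: continuousD; first apply: continuousD.
  - by apply: continuous_at_sum => i; exact: cdist.
  - by apply: cdist; apply: cln => //; rewrite -fg.
  - apply: continuous_at_sum => i; apply: continuous_at_sum => j; exact: cdist.
have B0 : B x0 < e.
  rewrite /B fg !subrr normr0 addr0 big1 ?add0r => [|i _]; last first.
    by rewrite subrr normr0.
  by rewrite big1 // => i _; rewrite big1 // => j _; rewrite subrr normr0.
have /(_ (nbhs_filter x0)) := cvgr_le _ cB _ B0; apply: filterS => x Bx.
exact: le_trans (sim_dist_le_sum _ _) Bx.
Qed.

Lemma sim_continuous_at_precomp (R : realType) (d : nat)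
    (X Y : topologicalType) (x0 : X) (h : X -> Y) (f : Y -> similarity R d) :
  {for x0, continuous h} -> sim_continuous_at (h x0) f ->
  sim_continuous_at x0 (f \o h).
Proof.
move=> ch [rf Of tf]; split=> [|i j|i].
- exact: continuous_comp ch rf.
- exact: continuous_comp ch (Of i j).
- exact: continuous_comp ch (tf i).
Qed.

Lemma pifs_sim_continuous_at (R : realType) (d : nat) (X : topologicalType)
    (D : set X) (I : finType) (Phi : X -> I -> similarity R d) (x0 : X) :
  open D -> parameterised_ifs D Phi -> D x0 ->
  forall i, sim_continuous_at x0 (Phi^~ i).
Proof.
move=> oD [_ rP OP tP] Dx0 i.
have atx0 (Y : topologicalType) (f : X -> Y) :
    {within D, continuous f} -> {for x0, continuous f}.
  by rewrite continuous_open_subspace // => /(_ x0); apply; exact: mem_set.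
split=> [|j k|j]; first exact: atx0 (rP i).
- apply: (continuous_comp (g := fun M : 'M[R]_d => M j k) (atx0 _ _ (OP i))).
  exact: coord_continuous.
- apply: (continuous_comp (g := fun M : 'cV[R]_d => M j 0) (atx0 _ _ (tP i))).
  exact: coord_continuous.
Qed.

Lemma joint_ifs_contracting (R : realType) (d : nat) (S T : topologicalType)
    (I1 I2 I3 : finType) (U : set S) (V : set T)
    (Phi1 : S -> I1 -> similarity R d) (Phi2 : T -> I2 -> similarity R d)
    (Phi3 : S * T -> I3 -> similarity R d) (x : S) (y : T) :
  parameterised_ifs U Phi1 -> parameterised_ifs V Phi2 ->
  parameterised_ifs (U `*` V) Phi3 -> U x -> V y ->
  forall i, contracting_similarity (joint_ifs Phi1 Phi2 Phi3 (x, y) i).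
Proof.
move=> P1 P2 P3 Ux Vy [[i|i]|i] /=.
- exact: (pifs_contracting P1).
- exact: (pifs_contracting P2).
- exact: (pifs_contracting P3).
Qed.

Lemma joint_ifs_sim_continuous_at (R : realType) (d : nat)
    (S T : topologicalType) (I1 I2 I3 : finType) (U : set S) (V : set T)
    (Phi1 : S -> I1 -> similarity R d) (Phi2 : T -> I2 -> similarity R d)
    (Phi3 : S * T -> I3 -> similarity R d) (x : S) (y : T) :
  open U -> open V ->
  parameterised_ifs U Phi1 -> parameterised_ifs V Phi2 ->
  parameterised_ifs (U `*` V) Phi3 -> U x -> V y ->
  forall i, sim_continuous_at (x, y) ((joint_ifs Phi1 Phi2 Phi3)^~ i).
Proof.
move=> oU oV P1 P2 P3 Ux Vy [[i|i]|i] /=.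
- apply: (sim_continuous_at_precomp (h := fst) (f := Phi1^~ i)).
    exact: cvg_fst.
  exact: (pifs_sim_continuous_at oU P1).
- apply: (sim_continuous_at_precomp (h := snd) (f := Phi2^~ i)).
    exact: cvg_snd.
  exact: (pifs_sim_continuous_at oV P2).
- apply: (pifs_sim_continuous_at _ P3) => //.
  rewrite openE => -[u v] [Uu Vv]; exists (U, V) => //=.
  by split; exact: open_nbhs_nbhs.
Qed.

(** * Stability of non-overlap and of small [Delta] *)

(** There are finitely many pairs of words of length [n], and each distinct pair has different maps
    throughout a neighbourhood of [x0]. *)
Lemma near_not_overlap_set (R : realType) (d : nat) (X : topologicalType)
    (D : set X) (I : finType) (Phi : X -> I -> similarity R d) (x0 : X)
    (n : nat) :
  (forall i, sim_continuous_at x0 (Phi^~ i)) -> D x0 ->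
  ~ overlap_set D Phi n x0 -> \forall x \near x0, ~ overlap_set D Phi n x.
Proof.
move=> cPhi Dx0 nH.
have : \forall x \near x0, forall ab : n.-tuple I * n.-tuple I,
    ab.1 != ab.2 -> ~ (word_map (Phi x) ab.1 =1 word_map (Phi x) ab.2).
  apply: filter_forall => -[a b] /=; have [->|ab] := eqVneq a b.
    by apply: nearW.
  have : \forall x \near x0, ~ (word_map (Phi x) a =1 word_map (Phi x) b).
    apply: near_sim_fun_neq; try exact: sim_continuous_at_word_map.
    by move=> eab; apply: nH; split=> //; exists a, b.
  by apply: filterS.
apply: filterS => x nab [_ [a [b [ab eab]]]]; exact: (nab (a, b)).
Qed.

(** A larger system minimises over more pairs of words. This transfers bounds from either family to
    the joint one. *)
Lemma Delta_le_map (R : realType) (d : nat) (I J : finType) (h : J -> I)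
    (phi : I -> similarity R d) (psi : J -> similarity R d) (n : nat) :
  injective h -> (forall j, phi (h j) = psi j) ->
  (Delta phi n <= Delta psi n)%E.
Proof.
move=> hI phih; apply/Order.TotalTheory.bigmin_geP; split=> [|[a b] /= ab].
  exact: leey.
apply: (bigmin_inf (map_tuple h a, map_tuple h b)) => /=.
  by apply: contra ab => /eqP/(congr1 val)/(inj_map hI)/val_inj ->.
by rewrite !(word_map_map _ phih).
Qed.

(** For each length one coinciding pair of words at [x0] gives a neighbourhood; the bound [N] makes
    their intersection finite. *)
Lemma near_Delta_le (R : realType) (d : nat) (X : topologicalType)
    (D : set X) (I : finType) (Phi : X -> I -> similarity R d) (x0 : X)
    (m N : nat) (omega : nat -> R) :
  (0 < d)%N -> open D -> parameterised_ifs D Phi ->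
  (forall n, (1 <= n)%N -> 0 < omega n) -> (1 <= m)%N ->
  overlap_set D Phi m x0 ->
  \forall x \near x0, forall n, (m <= n < N)%N ->
    (Delta (Phi x) n <= (omega n)%:E)%E.
Proof.
move=> d0 oD P omega0 m1 Hm; have Dx0 := Hm.1.
have : \forall x \near x0, forall k : 'I_N, (m <= k)%N ->
    (Delta (Phi x) k <= (omega k)%:E)%E.
  apply: filter_forall => k; have [mk|] := leqP m k; last by move=> _; apply: nearW.
  have [_ [a [b [ab eab]]]] := overlap_set_le mk Hm.
  have k0 := leq_trans m1 mk.
  have Phic i := pifs_contracting P i Dx0.
  have cont w := sim_continuous_at_word_map w (pifs_sim_continuous_at oD P Dx0).
  have sz w : (0 < size (tval (w : k.-tuple I)))%N by rewrite size_tuple.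
  have := near_sim_dist_le (cont a) (cont b)
    (word_map_inj d0 Phic (sz a) (sz b) eab) _ (omega0 _ k0).
  move=> /(_ (proj1 (andP (contracting_word_map Phic (sz a)).1))).
  by apply: filterS => x xab _; apply: (bigmin_inf (a, b)).
by apply: filterS => x xD n /andP[mn nN]; exact: (xD (Ordinal nN)).
Qed.

(** * Closed balls and their nested intersections *)

Lemma nbhs_le_dist (R : realType) (V : normedModType R) (x : V) (P : set V) :
  nbhs x P -> exists2 e : R, 0 < e & forall y, `|y - x| <= e -> P y.
Proof.
move=> /nbhs_closedballP[e]; rewrite closed_ballE // => eP.
by exists e%:num => // y yx; apply: eP; rewrite /closed_ball_ /= distrC.
Qed.

Lemma near_dist_le (R : realType) (V : normedModType R) (x y : V) (e : R) :
  `|x - y| < e -> \forall z \near y, `|z - x| <= e.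
Proof.
move=> xy; apply/nbhs_normP; exists (e - `|x - y|); first by rewrite /= subr_gt0.
move=> z /= yz; rewrite distrC ltW // (le_lt_trans (ler_distD y _ _)) //.
by rewrite addrC -ltrBrDr.
Qed.

(** Every later centre lies in ball [j], and the radii decay geometrically, so the centres form a
    Cauchy sequence. Its limit stays in each ball because the balls are closed. *)
Lemma nested_closed_balls (R : realType) (k : nat) (x : nat -> 'rV[R]_k)
    (e : nat -> R) :
  (forall j, 0 < e j) -> (forall j, e j.+1 <= e j / 2) ->
  (forall j y, `|y - x j.+1| <= e j.+1 -> `|y - x j| <= e j) ->
  exists z, forall j, `|z - x j| <= e j.
Proof.
move=> e0 eS xS.
have xD i j y : `|y - x (i + j)%N| <= e (i + j)%N -> `|y - x i| <= e i.
  by elim: j y => [|j IHj] y; rewrite ?addn0 // addnS => /xS/IHj.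
have xle i j : (i <= j)%N -> `|x j - x i| <= e i.
  by move=> /subnKC <-; apply: (@xD _ (j - i)%N); rewrite subrr normr0 ltW.
have ele j : e j <= e 0%N / 2 ^+ j.
  elim: j => [|j IHj]; first by rewrite expr0 divr1.
  by rewrite (le_trans (eS j)) // exprSr invfM mulrA ler_pM2r.
have e_small (eps : R) : 0 < eps -> exists i, e i < eps.
  move=> eps0.
  have [i _ /(_ i (leqnn i)) /= ei] :=
    near_infty_natSinv_expn_lt (PosNum (divr_gt0 eps0 (e0 0%N))).
  exists i; apply: le_lt_trans (ele i) _.
  by rewrite mulrC -ltr_pdivlMr // -div1r.
have /cauchy_cvgP xcvg : cauchy (x @ \oo).
  apply: cauchy_exP => eps /e_small[i ei]; exists (x i).
  exists i => // j /= ij; rewrite -ball_normE /= distrC.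
  exact: le_lt_trans (xle _ _ ij) ei.
exists (lim (x @ \oo)) => j; rewrite distrC.
have := closed_cvg _ (@closed_closed_ball_ _ _ (x j) (e j)) _ _ xcvg.
by apply; exists j => // i /= ji; rewrite /closed_ball_ /= distrC; exact: xle.
Qed.

(** * The alternating construction and its limit *)

Record stage (R : realType) (k1 k2 : nat) := Stage {
  level1 : nat;
  level2 : nat;
  center1 : 'rV[R]_k1;
  center2 : 'rV[R]_k2;
  radius : R
}.


Theorem theorem2p1 (R : realType) (d k1 k2 : nat) (d_gt0 : (0 < d)%N)
    (U : set 'rV[R]_k1) (V : set 'rV[R]_k2) (openU : open U) (openV : open V)
    (I1 I2 I3 : finType)
    (Phi1 : 'rV[R]_k1 -> I1 -> similarity R d)
    (Phi2 : 'rV[R]_k2 -> I2 -> similarity R d)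
    (Phi3 : 'rV[R]_k1 * 'rV[R]_k2 -> I3 -> similarity R d)
    (Phi1_ifs : parameterised_ifs U Phi1)
    (Phi2_ifs : parameterised_ifs V Phi2)
    (Phi3_ifs : parameterised_ifs (U `*` V) Phi3) :
  let Phi := joint_ifs Phi1 Phi2 Phi3 in
  let H1 := overlap_set U Phi1 in
  let H1s := new_overlap_set U Phi1 in
  let H2 := overlap_set V Phi2 in
  let H2s := new_overlap_set V Phi2 in
  let H3 := overlap_set (U `*` V) Phi in
  (\bigcup_(n >= 1) H1 n !=set0 /\ \bigcup_(n >= 1) H2 n !=set0) ->
  (forall (n0 m0 : nat) (u : 'rV[R]_k1) (v : 'rV[R]_k2) (eps : R),
    (1 <= n0)%N -> (1 <= m0)%N -> H1 n0 u -> H2 m0 v -> 0 < eps ->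
    exists u1 : 'rV[R]_k1,
      [/\ (\bigcup_(n >= (maxn n0 m0).+1) H1s n) u1,
          `|u - u1| < eps
        & forall eps' : R, 0 < eps' ->
          exists v1 : 'rV[R]_k2,
            [/\ (\bigcup_(n >= (maxn n0 m0).+1) H2s n) v1,
                `|v - v1| < eps'
              & ~ H3 (maxn n0 m0) (u1, v1)]]) ->
  forall omega : nat -> R, (forall n, (1 <= n)%N -> 0 < omega n) ->
  exists u v, [/\ U u, V v,
    \forall n \near \oo, (Delta (Phi (u, v)) n <= (omega n)%:E)%E
    & ~ exact_overlap (Phi (u, v))].
Proof.
move=> Phi H1 H1s H2 H2s H3 [[u0 [n0 n0_gt0 Hu0]] [v0 [m0 m0_gt0 Hv0]]] dense.
move=> omega omega0.
pose valid (s : stage R k1 k2) := [/\ (1 <= level1 s)%N, (1 <= level2 s)%N,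
  H1 (level1 s) (center1 s), H2 (level2 s) (center2 s) & 0 < radius s].
(* The ranges from [level2 s] to [level2 s'] of consecutive stages are adjacent, so together they
   cover all large [n]. The conditions hold on whole closed balls and hence at the limit point. *)
pose refines (s s' : stage R k1 k2) := [/\ (level1 s < level1 s')%N,
  (level2 s < level2 s')%N, radius s' <= radius s / 2 &
  forall x y, `|x - center1 s'| <= radius s' -> `|y - center2 s'| <= radius s' ->
    [/\ `|x - center1 s| <= radius s, `|y - center2 s| <= radius s,
      U x /\ V y,
      forall n, (level2 s <= n < level2 s')%N ->
        (Delta (Phi (x, y)) n <= (omega n)%:E)%E
    & ~ H3 (maxn (level1 s) (level2 s)) (x, y)]].
have step s : valid s -> exists2 s', valid s' & refines s s'.
  case: s => n m u v e [/= n_gt0 m_gt0 Hu Hv e_gt0].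
  have [u1 [[n1 /= n1_gt [Hu1 _]] uu1 densev]] :=
    dense n m u v e n_gt0 m_gt0 Hu Hv e_gt0.
  (* v covers the levels n with m <= n < n1; then u1, chosen before m1 is known,
     covers n1 <= n < m1. *)
  have [del del_gt0 near_v] := nbhs_le_dist
    (near_Delta_le n1 d_gt0 openV Phi2_ifs omega0 m_gt0 Hv).
  (* Distance below [e] keeps [v1] inside the current ball; distance below [del] keeps the bounds of
     [near_v] valid around [v1]. *)
  have del'_gt0 : 0 < Num.min e del by rewrite lt_min e_gt0.
  have [v1 [[m1 /= m1_gt [Hv1 _]] vv1 nH3]] := densev _ del'_gt0.
  move: vv1; rewrite lt_min => /andP[vv1_e vv1_del].
  have [nn1 mn1] : (n < n1)%N /\ (m < n1)%N by apply/andP; rewrite -gtn_max.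
  have [nm1 mm1] : (n < m1)%N /\ (m < m1)%N by apply/andP; rewrite -gtn_max.
  have n1_gt0 : (0 < n1)%N by apply: leq_ltn_trans nn1.
  have m1_gt0 : (0 < m1)%N by apply: leq_ltn_trans mm1.
  have [Uu1 Vv1] : U u1 /\ V v1 by split; [exact: Hu1.1 | exact: Hv1.1].
  have UVuv1 : (U `*` V) (u1, v1) by [].
  have [[A B] /= [nA nB] ABH3] := near_not_overlap_set
    (joint_ifs_sim_continuous_at openU openV Phi1_ifs Phi2_ifs Phi3_ifs Uu1 Vv1)
    UVuv1 nH3.
  have [ex ex_gt0 near_u1] := nbhs_le_dist (filterI
    (filterI (near_dist_le uu1) (open_nbhs_nbhs (conj openU Uu1)))
    (filterI nA (near_Delta_le m1 d_gt0 openU Phi1_ifs omega0 n1_gt0 Hu1))).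
  (* The bounds of [near_v] concern distance to [v], so the ball about [v1] has to fit into the
     [del]-ball about [v]. *)
  have [ey ey_gt0 near_v1] := nbhs_le_dist (filterI
    (filterI (near_dist_le vv1_e) (open_nbhs_nbhs (conj openV Vv1)))
    (filterI nB (near_dist_le vv1_del))).
  exists (Stage n1 m1 u1 v1 (Num.min (e / 2) (Num.min ex ey))).
    by split=> //=; rewrite !lt_min ex_gt0 ey_gt0 divr_gt0.
  split=> //= [|x y]; first by rewrite ge_min lexx.
  rewrite !le_min => /and3P[_ xu1 _] /and3P[_ _ yv1].
  have [[xu Ux] [Ax Dx]] := near_u1 _ xu1.
  have [[yv Vy] [By yv_del]] := near_v1 _ yv1.
  split=> // [k /andP[mk km1]|]; last exact: (ABH3 (x, y)).
  have [kn1|n1k] := ltnP k n1.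
    apply: le_trans (near_v _ yv_del k _); last by rewrite mk.
    by apply: (Delta_le_map (h := fun i => inl (inr i))) => [i j []|].
  apply: le_trans (Dx k _); last by rewrite n1k.
  by apply: (Delta_le_map (h := fun i => inl (inl i))) => [i j []|].
have s0_valid : valid (Stage n0 m0 u0 v0 1) by split=> //=; exact: ltr01.
(* Choosing in the subtype of valid stages lets [step] apply at every turn. *)
have [S [S0 SS]] := @dependent_choice {s | valid s}
  (fun s s' => refines (sval s) (sval s'))
  (fun s => let: exist s sP := s in
     let: exist2 s' s'P ss' := cid2 (step s sP) in exist _ (exist _ s' s'P) ss')
  (exist _ _ s0_valid).
pose n_ j := level1 (sval (S j)); pose m_ j := level2 (sval (S j)).
pose u_ j := center1 (sval (S j)); pose v_ j := center2 (sval (S j)).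
pose e_ j := radius (sval (S j)).
have e_gt0 j : 0 < e_ j by rewrite /e_; case: (svalP (S j)).
have e_half j : e_ j.+1 <= e_ j / 2 by case: (SS j).
(* [refines] speaks of pairs; to nest the balls of one factor, the other coordinate is set to its
   own centre. *)
have center_in (k : nat) (w : 'rV[R]_k) j : `|w - w| <= e_ j.
  by rewrite subrr normr0 ltW.
have [us us_in] : exists z, forall j, `|z - u_ j| <= e_ j.
  apply: nested_closed_balls => // j x xu.
  have [_ _ _ ball_in] := SS j.
  by have [] := ball_in x (v_ j.+1) xu (center_in _ _ _).
have [vs vs_in] : exists z, forall j, `|z - v_ j| <= e_ j.
  apply: nested_closed_balls => // j y yv.
  have [_ _ _ ball_in] := SS j.
  by have [] := ball_in (u_ j.+1) y (center_in _ _ _) yv.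
have limit j : [/\ U us /\ V vs,
    forall n, (m_ j <= n < m_ j.+1)%N -> (Delta (Phi (us, vs)) n <= (omega n)%:E)%E
  & ~ H3 (maxn (n_ j) (m_ j)) (us, vs)].
  by have [_ _ _ /(_ us vs (us_in _) (vs_in _))[_ _]] := SS j.
have [[Uus Vvs] _ _] := limit 0%N.
have m_ge j : (j <= m_ j)%N.
  elim: j => // j /leq_ltn_trans; apply; by case: (SS j).
exists us, vs; split=> //.
  exists (m_ 0%N) => // n /= m0n.
  have [j jn] : exists j, (m_ j <= n < m_ j.+1)%N.
    (* Take the last stage whose level is at most [n]. By [m_ge] its index is at most [n], so the
       search is finite. *)
    have [j jn jmax] :=
      @arg_maxnP _ (@ord0 n) (fun j : 'I_n.+1 => (m_ j <= n)%N) val m0n.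
    exists j; rewrite jn ltnNge; apply/negP => jn'.
    have jn1 : (j.+1 < n.+1)%N by rewrite ltnS (leq_trans (m_ge _)).
    by have := jmax (Ordinal jn1) jn'; rewrite /= ltnn.
  by have [_ + _] := limit j; apply.
have UVs : (U `*` V) (us, vs) by [].
have Phi_contracting := joint_ifs_contracting Phi1_ifs Phi2_ifs Phi3_ifs Uus Vvs.
move=> /(exact_overlap_overlap_set d_gt0 UVs Phi_contracting)[n Hn].
(* Stage [n] excludes overlaps at a level at least [m_ n], hence at least [n], to which an overlap
   at level [n] would propagate. *)
have [_ _] := limit n; apply; apply: overlap_set_le Hn.
by rewrite leq_max (m_ge n) orbT.
Qed.
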